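(* Let $n\ge 1$. The set of totally symmetric self-complementary plane partitions inside a $2n\times 2n\times 2n$ box is in bijection with the set $SST_n$ of semistandard Young tableaux $y=(y_{i,j})$ of staircase shape $\delta_n=(n,n-1,\dots,2,1)$ with all entries at most $n$ and satisfying $y_{i,j}\le y_{i-1,j+1}+1$ whenever both entries are defined.
   Context: A plane partition inside a $2n\times 2n\times 2n$ box is an array $t=(t_{i,j})_{1\le i,j\le 2n}$ of integers in $\{0,1,\dots,2n\}$ that weakly decrease along rows and down columns; equivalently the set of unit cubes $\{(i,j,k): 1\le k\le t_{i,j}\}$. It is totally symmetric if this set of cubes is invariant under all permutations of the three coordinates, and self-complementary if $t_{i,j}+t_{2n+1-i,2n+1-j}=2n$ for all $i,j$. A semistandard Young tableau of staircase shape $\delta_n$ is an array $(y_{i,j})$, $1\le i\le n$, $1\le j\le n+1-i$, of positive integers weakly increasing from left to right along rows and strictly increasing from top to bottom down columns. *)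

(* Defs.v *)
From mathcomp Require Import all_boot perm matrix.

Set Implicit Arguments.
Unset Strict Implicit.
Unset Printing Implicit Defensive.

(* All coordinates are shifted to start at 0: row i, column j here is row i+1, *)
(* column j+1 of the usual arrays. Entries are not shifted.                    *)

Section PlanePartitions.
Variable m : nat.

Definition plane_partition (t : 'M['I_m.+1]_m) : bool :=
  [forall i : 'I_m, forall j1 : 'I_m, forall j2 : 'I_m,
     (j1 <= j2) ==> (t i j2 <= t i j1)]
  && [forall i1 : 'I_m, forall i2 : 'I_m, forall j : 'I_m,
        (i1 <= i2) ==> (t i2 j <= t i1 j)].

(* A cube is its triple of coordinates; the third one is also shifted, so that *)
(* 1 <= k <= t_(i,j) becomes k < t i j.                                        *)
Definition cubes (t : 'M['I_m.+1]_m) : {set {ffun 'I_3 -> 'I_m}} :=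
  [set c : {ffun 'I_3 -> 'I_m} |
    c (inord 2) < t (c (inord 0)) (c (inord 1))].

Definition permute_cube (s : 'S_3) (c : {ffun 'I_3 -> 'I_m}) :
  {ffun 'I_3 -> 'I_m} := [ffun a => c (s a)].

Definition totally_symmetric (t : 'M['I_m.+1]_m) : bool :=
  [forall s : 'S_3, permute_cube s @: cubes t == cubes t].

Definition self_complementary (t : 'M['I_m.+1]_m) : bool :=
  [forall i : 'I_m, forall j : 'I_m, t i j + t (rev_ord i) (rev_ord j) == m].

End PlanePartitions.

Definition TSSCPP (n : nat) : {set 'M['I_(2 * n).+1]_(2 * n)} :=
  [set t | [&& plane_partition t, totally_symmetric t & self_complementary t]].

(* Cells of the staircase (n, n-1, ..., 1): row i (from 0) has n - i cells.    *)
Notation staircase n := {c : 'I_n * 'I_n | c.1 + c.2 < n}.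

Definition cell_row n (c : staircase n) : 'I_n := (val c).1.
Definition cell_col n (c : staircase n) : 'I_n := (val c).2.

Section StaircaseTableaux.
Variable n : nat.

Definition semistandard (y : {ffun staircase n -> 'I_n.+1}) : bool :=
  [&& [forall c : staircase n, 0 < y c],
      [forall c : staircase n, forall d : staircase n,
         (cell_row c == cell_row d) && (cell_col c <= cell_col d)
           ==> (y c <= y d)]
    & [forall c : staircase n, forall d : staircase n,
         (cell_col c == cell_col d) && (cell_row c < cell_row d)
           ==> (y c < y d)]].

(* c = (i, j) and d = (i - 1, j + 1).                                          *)
Definition antidiagonal_bound (y : {ffun staircase n -> 'I_n.+1}) : bool :=
  [forall c : staircase n, forall d : staircase n,
     (cell_row c == (cell_row d).+1 :> nat)
       && (cell_col d == (cell_col c).+1 :> nat)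
       ==> (y c <= (y d).+1)].

(* Entries are at most n by the choice of the codomain 'I_n.+1.                *)
Definition SST : {set {ffun staircase n -> 'I_n.+1}} :=
  [set y | semistandard y && antidiagonal_bound y].

End StaircaseTableaux.

(* Main.v *)
(* By symmetry and complementation, a TSSCPP t is determined by its corner
   (t_(i,j)) with i, j <= n, a symmetric array with entries in [n, 2n]. The only
   condition that complementation adds is t_(i,n) >= 2n+1-i: it says that the
   cubes on the boundary of the corner lie in the partition. Reading the corner
   along its diagonals, y_(i,j) = 2n + i - t_(j,i+j-1), turns monotonicity of t
   into strictness of the columns of y and y_(i,j) <= y_(i-1,j+1) + 1, while the
   condition on t_(i,n) becomes y_(i,j) <= n; together these imply that the rows
   of y increase weakly. *)

Require Import Defs.
From mathcomp Require Import all_boot perm matrix.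
From mathcomp Require Import zify.

Set Implicit Arguments.
Unset Strict Implicit.
Unset Printing Implicit Defensive.

(** * Heights of downward closed predicates *)

Lemma ltn_find_predC (P : pred nat) m z :
    (forall u v, u <= v -> v < m -> P v -> P u) -> z < m ->
  (z < find (predC P) (iota 0 m)) = P z.
Proof.
move=> downP z_m; apply/idP/idP => [z_lt | Pz].
  by have := before_find 0 z_lt; rewrite nth_iota //= => /negbFE.
rewrite ltnNge; apply/negP => le_z.
have hasC : has (predC P) (iota 0 m) by rewrite has_find size_iota; lia.
have := nth_find 0 hasC; rewrite nth_iota /=; last lia.
by rewrite add0n (downP _ z).
Qed.

Lemma eq_from_ltn m a b :
  a <= m -> b <= m -> (forall z, z < m -> (z < a) = (z < b)) -> a = b.
Proof.
move=> a_m b_m eqab; apply/eqP; rewrite eqn_leq; apply/andP; split.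
  by case: (leqP a b) => // ba; have := eqab b; lia.
by case: (leqP b a) => // ab; have := eqab a; lia.
Qed.

(** * Partitions and tableaux as functions on natural numbers *)

(** [tf_sym] and [tf_swap] express invariance of the set of cubes under the two adjacent
    transpositions of the coordinates. Through [tf_sym], the column condition [tf_dec] also governs
    the rows. *)
Record tsscpp_fun (m : nat) (T : nat -> nat -> nat) : Prop := TsscppFun {
  tf_le : forall x y, x < m -> y < m -> T x y <= m;
  tf_dec : forall x x' y, x <= x' -> x' < m -> y < m -> T x' y <= T x y;
  tf_sym : forall x y, x < m -> y < m -> T x y = T y x;
  tf_swap : forall x y z, x < m -> y < m -> z < m -> (z < T x y) = (y < T x z);
  tf_compl : forall x y, x < m -> y < m -> T x y + T (m - x.+1) (m - y.+1) = m
}.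

Record sst_fun (n : nat) (Y : nat -> nat -> nat) : Prop := SstFun {
  sf_gt0 : forall a b, a + b < n -> 0 < Y a b;
  sf_le : forall a b, a + b < n -> Y a b <= n;
  sf_row : forall a b b', b <= b' -> a + b' < n -> Y a b <= Y a b';
  sf_col : forall a a' b, a < a' -> a' + b < n -> Y a b < Y a' b;
  sf_anti : forall a b, a.+1 + b < n -> Y a.+1 b <= (Y a b.+1).+1
}.

(** The value [2n + i - t_(j,i+j-1)] at [i = a + 1] and [j = b + 1]. *)
Definition tableau_of n (T : nat -> nat -> nat) a b := 2 * n + a.+1 - T b (a + b).

(* The cube (x, n-1, 2n-1-x) lies on the boundary between a permutation of
   itself and its complement, hence belongs to the partition. *)
Lemma tsscpp_middle n T x :
  tsscpp_fun (2 * n) T -> x < n -> 2 * n - x <= T x n.-1.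
Proof.
move=> tT x_n.
have := tf_compl tT (x := x) (y := n.-1).
have := tf_swap tT (x := n) (y := 2 * n - x.+1) (z := x).
have := tf_sym tT (x := n) (y := 2 * n - x.+1).
have := tf_sym tT (x := n) (y := x).
have := tf_sym tT (x := n.-1) (y := x).
have := tf_dec tT (x := n.-1) (x' := n) (y := x).
have -> : 2 * n - n.-1.+1 = n by lia.
lia.
Qed.

Lemma sst_tableau_of n T :
  tsscpp_fun (2 * n) T -> sst_fun n (tableau_of n T).
Proof.
move=> tT; rewrite /tableau_of.
have decr x y y' : y <= y' -> x < 2 * n -> y' < 2 * n -> T x y' <= T x y.
  move=> yy' xm ym; rewrite (tf_sym tT (x := x)) // (tf_sym tT (x := x)) //; last lia.
  exact: (tf_dec tT).
split=> [a b abn | a b abn | a b b' bb' abn | a a' b aa' abn | a b abn].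
- have := tf_le tT (x := b) (y := a + b); lia.
(* The boundary bound [2 * n - b <= T b n.-1] makes the entry at most [a + b + 1], hence at most
   [n]. *)
- have := tsscpp_middle tT (x := b); have := decr b (a + b) n.-1; lia.
- have := tf_dec tT (x := b) (x' := b') (y := a + b').
  have := decr b (a + b) (a + b'); lia.
- have := decr b (a + b) (a' + b).
  have := tf_le tT (x := b) (y := a + b); lia.
- have := tf_dec tT (x := b) (x' := b.+1) (y := a + b.+1).
  have -> : a.+1 + b = a + b.+1 by lia.
  lia.
Qed.

(** * The corner of a partition, read off a tableau *)

(** [cf_middle] is the boundary condition on column [n.-1], spread to all columns of the corner by
    monotonicity. *)
Record corner_fun (n : nat) (S : nat -> nat -> nat) : Prop := CornerFun {
  cf_ge : forall x y, x < n -> y < n -> n <= S x y;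
  cf_le : forall x y, x < n -> y < n -> S x y <= 2 * n;
  cf_sym : forall x y, S x y = S y x;
  cf_dec : forall x x' y, x <= x' -> x' < n -> y < n -> S x' y <= S x y;
  cf_middle : forall x y, x < n -> y < n -> 2 * n - x <= S x y
}.

(** Solves [tableau_of] for the partition: the cell is [a = |x - y|], [b = min(x, y)], and [maxn]
    and [minn] make the array symmetric. *)
Definition corner_of n (Y : nat -> nat -> nat) x y :=
  2 * n + (maxn x y - minn x y).+1 - Y (maxn x y - minn x y) (minn x y).

(** Columns start at 1 or more and increase strictly. This keeps the corner entries at most
    [2 * n]. *)
Lemma sst_gt_row n Y a b : sst_fun n Y -> a + b < n -> a < Y a b.
Proof.
move=> sY; elim: a => [|a IHa] abn; first exact: sf_gt0 sY _ _ abn.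
have := IHa; have := sf_col sY (ltnSn a) abn; lia.
Qed.

Lemma corner_corner_of n Y : sst_fun n Y -> corner_fun n (corner_of n Y).
Proof.
move=> sY; rewrite /corner_of.
have sym x y : corner_of n Y x y = corner_of n Y y x.
  by rewrite /corner_of maxnC minnC.
have step x y : x.+1 < n -> y < n -> corner_of n Y x.+1 y <= corner_of n Y x y.
  (* A step towards the diagonal uses the antidiagonal bound; a step away from it uses strictness of
     a column. *)
  move=> xn yn; rewrite /corner_of; case: (ltnP x y) => xy.
    have [-> ->] : maxn x.+1 y = y /\ minn x.+1 y = x.+1 by lia.
    rewrite -(subnSK xy); have := sf_anti sY (a := y - x.+1) (b := x); lia.
  have [-> ->] : maxn x.+1 y = x.+1 /\ minn x.+1 y = y by lia.
  rewrite subSn //.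
  have := sf_col sY (a := x - y) (a' := (x - y).+1) (b := y); lia.
have decr x x' y : x <= x' -> x' < n -> y < n ->
    corner_of n Y x' y <= corner_of n Y x y.
  move=> /subnK <-; elim: (x' - x) => [|d IHd] //= dn yn.
  by apply: leq_trans (step _ _ dn yn) (IHd _ yn); lia.
split=> // x y xn yn; rewrite -/(corner_of n Y x y).
- rewrite /corner_of.
  have := sf_le sY (a := maxn x y - minn x y) (b := minn x y); lia.
- rewrite /corner_of.
  have := sst_gt_row (a := maxn x y - minn x y) (b := minn x y) sY; lia.
(* Row [x] is smallest at index [n.-1], which corresponds to the last cell of a tableau row, with
   entry at most [n]. *)
- apply: leq_trans (_ : corner_of n Y n.-1 x <= _); last first.
    rewrite [leqRHS]sym; apply: decr; lia.
  rewrite /corner_of (maxn_idPl _) ?(minn_idPr _); try lia.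
  have := sf_le sY (a := n.-1 - x) (b := x); lia.
Qed.

(* A cube with at most one coordinate [>= n] is moved above the corner by a
   permutation; any other one is first replaced with its complement. *)
Definition cube_of n (S : nat -> nat -> nat) x y z :=
  let c u := 2 * n - u.+1 in
  if x < n then
    if y < n then z < S x y
    else if z < n then y < S x z else ~~ (c x < S (c y) (c z))
  else if y < n then
    if z < n then x < S y z else ~~ (c y < S (c x) (c z))
  else ~~ (c z < S (c x) (c y)).

(** * Filling the box from its corner *)

Section CubeOf.
Variables (n : nat) (S : nat -> nat -> nat).
Hypothesis cS : corner_fun n S.

Lemma cube_of_sym x y z : cube_of n S x y z = cube_of n S y x z.
Proof.
rewrite /cube_of (cf_sym cS x y) (cf_sym cS (2 * n - x.+1) (2 * n - y.+1)).
by case: (x < n); case: (y < n).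
Qed.

Lemma cube_of_swap x y z : x < 2 * n -> y < 2 * n -> z < 2 * n ->
  cube_of n S x y z = cube_of n S x z y.
Proof.
move=> xm ym zm; rewrite /cube_of (cf_sym cS (2 * n - z.+1) (2 * n - y.+1)).
case: (ltnP x n) => xn; case: (ltnP y n) => yn; case: (ltnP z n) => zn //=.
(* With all coordinates below [n] both sides hold, since [n <= S]. In the last case all are at least
   [n], and both sides fail by complementation. *)
- have := cf_ge cS xn yn; have := cf_ge cS xn zn; lia.
- by rewrite (cf_sym cS y).
- have := cf_ge cS (x := 2 * n - x.+1) (y := 2 * n - y.+1).
  have := cf_ge cS (x := 2 * n - x.+1) (y := 2 * n - z.+1).
  lia.
Qed.

Lemma cube_of_compl x y z : x < 2 * n -> y < 2 * n -> z < 2 * n ->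
  cube_of n S (2 * n - x.+1) (2 * n - y.+1) (2 * n - z.+1) = ~~ cube_of n S x y z.
Proof.
move=> xm ym zm.
have cc u : u < 2 * n -> 2 * n - (2 * n - u.+1).+1 = u by lia.
have cn u : u < 2 * n -> (2 * n - u.+1 < n) = ~~ (u < n) by lia.
rewrite /cube_of !cc ?cn //.
case: (ltnP x n) => xn; case: (ltnP y n) => yn; case: (ltnP z n) => zn //=;
  by rewrite ?negbK.
Qed.

(** Makes every column of cubes an initial segment, so that it has a height. After ordering
    [x <= y], the case that takes work is [x < n <= y]. *)
Lemma cube_of_down x y u v : x < 2 * n -> y < 2 * n ->
  u <= v -> v < 2 * n -> cube_of n S x y v -> cube_of n S x y u.
Proof.
wlog xy : x y / x <= y => [IH xm ym uv vm | xm ym uv vm].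
  case: (leqP x y) => [xy | /ltnW yx]; first exact: IH.
  by rewrite ![cube_of _ _ x _ _]cube_of_sym; apply: IH.
rewrite /cube_of; case: (ltnP x n) => xn; case: (ltnP y n) => yn; try lia.
- case: (ltnP v n) => vn.
    have -> : u < n by lia.
    have := cf_dec cS (x := u) (x' := v) (y := x) uv vn xn.
    rewrite (cf_sym cS x u) (cf_sym cS x v); lia.
  (* For [u < n <= v] the test passes from the complement to the corner. With [c w = 2 * n - w.+1],
     the boundary condition gives [y < S (c y) (c v) <= c x], and [2 * n - x <= S x u] then yields
     [y < S x u]. *)
  case: (ltnP u n) => un.
    have := cf_middle cS xn un.
    have := cf_middle cS (x := 2 * n - y.+1) (y := 2 * n - v.+1).
    lia.
  have := cf_dec cS (x := 2 * n - v.+1) (x' := 2 * n - u.+1) (y := 2 * n - y.+1).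
  rewrite (cf_sym cS (2 * n - u.+1)) (cf_sym cS (2 * n - v.+1)); lia.
Qed.

(** The first missing level over [(x, y)]; [find] returns [2 * n] when the column is full. *)
Definition fill x y := find (predC (cube_of n S x y)) (iota 0 (2 * n)).

Lemma ltn_fill x y z : x < 2 * n -> y < 2 * n -> z < 2 * n ->
  (z < fill x y) = cube_of n S x y z.
Proof. by move=> xm ym; apply: ltn_find_predC => u v; apply: cube_of_down. Qed.

Lemma fill_le x y : fill x y <= 2 * n.
Proof. by rewrite /fill -{2}(size_iota 0 (2 * n)) find_size. Qed.

Lemma tsscpp_fill : tsscpp_fun (2 * n) fill.
Proof.
split=> [x y _ _ | x x' y xx' xm ym | x y xm ym | x y z xm ym zm | x y xm ym].
- exact: fill_le.
(* Otherwise the cube over [(x', y)] at level [fill x y] is present. Permuting [x'] into third place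
   allows lowering it to [x], which contradicts the height over [(x, y)]. *)
- rewrite leqNgt; apply/negP => lt_fill.
  have zm : fill x y < 2 * n by have := fill_le x' y; lia.
  move: (ltnn (fill x y)); rewrite ltn_fill ?(leq_ltn_trans xx') // => /negP[].
  rewrite cube_of_sym cube_of_swap ?(leq_ltn_trans xx') //.
  apply: (cube_of_down (v := x')) => //.
  by rewrite -cube_of_swap // -cube_of_sym -ltn_fill.
- apply: (eq_from_ltn (fill_le _ _) (fill_le _ _)) => z zm.
  by rewrite !ltn_fill // cube_of_sym.
- by rewrite !ltn_fill // cube_of_swap.
- suff -> : fill (2 * n - x.+1) (2 * n - y.+1) = 2 * n - fill x y.
    by have := fill_le x y; lia.
  apply: (eq_from_ltn (fill_le _ _)) => [|z zm]; first lia.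
  rewrite ltn_fill; try lia.
  have {1}-> : z = 2 * n - (2 * n - z.+1).+1 by lia.
  rewrite cube_of_compl -?ltn_fill; lia.
Qed.

Lemma fill_corner x y : x < n -> y < n -> fill x y = S x y.
Proof.
move=> xn yn; apply: (eq_from_ltn (fill_le _ _) (cf_le cS xn yn)) => z zm.
by rewrite ltn_fill /cube_of ?xn ?yn //; lia.
Qed.

End CubeOf.

(** * The two constructions are mutually inverse *)

(** The corner determines the partition: the permutations and the complementation used by [cube_of]
    are symmetries of [T]. *)
Lemma tsscpp_cube_of n T S x y z : tsscpp_fun (2 * n) T ->
    (forall u v, u < n -> v < n -> S u v = T u v) ->
    x < 2 * n -> y < 2 * n -> z < 2 * n ->
  cube_of n S x y z = (z < T x y).
Proof.
move=> tT ST xm ym zm.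
have compl u v w : u < 2 * n -> v < 2 * n -> w < 2 * n ->
    ~~ (2 * n - w.+1 < T (2 * n - u.+1) (2 * n - v.+1)) = (w < T u v).
  by move=> um vm wm; have := tf_compl tT um vm; lia.
have swap := tf_swap tT; have sym := tf_sym tT.
rewrite /cube_of.
case: (ltnP x n) => xn; case: (ltnP y n) => yn; last by rewrite ST ?compl //; lia.
- by rewrite ST.
- case: (ltnP z n) => zn; first by rewrite ST // swap.
  rewrite ST ?compl //; try lia.
  by rewrite (sym y) // swap // sym // swap // (sym z) // swap.
- case: (ltnP z n) => zn; first by rewrite ST // -swap // sym.
  rewrite ST ?compl //; try lia.
  by rewrite -swap.
Qed.

Lemma eq_sst_fun n Y Z : sst_fun n Y ->
  (forall a b, a + b < n -> Z a b = Y a b) -> sst_fun n Z.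
Proof.
move=> sY ZY.
split=> [a b abn | a b abn | a b b' bb' abn | a a' b aa' abn | a b abn];
  rewrite !ZY //; try lia.
- exact: sf_gt0 sY _ _ _.
- exact: sf_le sY _ _ _.
- exact: sf_row sY _ _ _ _ _.
- exact: sf_col sY _ _ _ _ _.
- exact: sf_anti sY _ _ _.
Qed.

Lemma tableau_ofK n T Y x y : tsscpp_fun (2 * n) T ->
    (forall a b, a + b < n -> Y a b = tableau_of n T a b) ->
  x < 2 * n -> y < 2 * n -> fill n (corner_of n Y) x y = T x y.
Proof.
move=> tT YT xm ym.
have cS := corner_corner_of (eq_sst_fun (sst_tableau_of tT) YT).
apply: (eq_from_ltn (fill_le _ _ _ _) (tf_le tT xm ym)) => z zm.
rewrite ltn_fill //; apply: tsscpp_cube_of => // u v un vn.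
rewrite /corner_of YT; last lia.
rewrite /tableau_of subnK; last lia.
have -> : T (minn u v) (maxn u v) = T u v.
  by case: (leqP u v) => // _; apply: tf_sym tT _ _ _ _; lia.
have := tf_le tT (x := u) (y := v); lia.
Qed.

Lemma corner_ofK n Y a b : sst_fun n Y -> a + b < n ->
  tableau_of n (fill n (corner_of n Y)) a b = Y a b.
Proof.
move=> sY abn; have cS := corner_corner_of sY.
rewrite /tableau_of fill_corner //; try lia.
rewrite /corner_of (maxn_idPr _) ?(minn_idPl _) ?addnK; try lia.
have := sf_le sY abn; have := sst_gt_row sY abn; lia.
Qed.

(** * Passage to matrices and finite functions *)

(** Extended by 0 outside the matrix, so that index arithmetic takes place in [nat] without bound
    proofs. *)
Definition entry m (t : 'M['I_m.+1]_m) (x y : nat) : nat :=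
  if insub x is Some i then if insub y is Some j then val (t i j) else 0 else 0.

Lemma entryE m (t : 'M['I_m.+1]_m) (i j : 'I_m) : entry t i j = t i j.
Proof. by rewrite /entry !valK. Qed.

Definition fill_mx m (T : nat -> nat -> nat) : 'M['I_m.+1]_m :=
  \matrix_(i, j) inord (T i j).

Lemma fill_mxE m T x y : (forall x y, x < m -> y < m -> T x y <= m) ->
  x < m -> y < m -> entry (fill_mx m T) x y = T x y.
Proof.
move=> Tm xm ym; rewrite (entryE _ (Ordinal xm) (Ordinal ym)) mxE inordK //=.
exact: Tm.
Qed.

Definition tableau_entry n (y : {ffun staircase n -> 'I_n.+1}) (a b : nat) : nat :=
  if insub a is Some i then if insub b is Some j then
    if insub (i, j) is Some c then val (y c) else 0 else 0 else 0.

Lemma tableau_entryE n (y : {ffun staircase n -> 'I_n.+1}) (c : staircase n) :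
  tableau_entry y (cell_row c) (cell_col c) = y c.
Proof.
rewrite /tableau_entry !valK /cell_row /cell_col -surjective_pairing.
by rewrite (valK c).
Qed.

Lemma staircaseP n a b : a + b < n ->
  exists c : staircase n, cell_row c = a :> nat /\ cell_col c = b :> nat.
Proof.
move=> abn; have an : a < n by lia.
have bn : b < n by lia.
by exists (exist _ (Ordinal an, Ordinal bn) abn).
Qed.

Lemma sst_funP n (y : {ffun staircase n -> 'I_n.+1}) :
  y \in SST n <-> sst_fun n (tableau_entry y).
Proof.
rewrite inE /semistandard /antidiagonal_bound; split.
  case/andP=> /and3P[/forallP gt0 /forallP row /forallP col] /forallP anti.
  split=> [a b abn | a b abn | a b b' bb' abn | a a' b aa' abn | a b abn].
  - by have [c [<- <-]] := staircaseP abn; rewrite tableau_entryE gt0.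
  - by have [c [<- <-]] := staircaseP abn; rewrite tableau_entryE -ltnS.
  - have abn1 : a + b < n by lia.
    have [c [rc cc]] := staircaseP abn1; have [d [rd cd]] := staircaseP abn.
    rewrite -{1}rc -rd -cc -cd !tableau_entryE.
    have /forallP/(_ d)/implyP := row c; apply.
    by rewrite -val_eqE /= rc rd eqxx cc cd.
  - have abn1 : a + b < n by lia.
    have [c [rc cc]] := staircaseP abn1; have [d [rd cd]] := staircaseP abn.
    rewrite -rc -rd -{1}cc -cd !tableau_entryE.
    have /forallP/(_ d)/implyP := col c; apply.
    by rewrite -val_eqE /= rc rd cc cd eqxx.
  - have abn1 : a + b.+1 < n by lia.
    have [d [rd cd]] := staircaseP abn1; have [c [rc cc]] := staircaseP abn.
    rewrite -rc -rd -cd -cc !tableau_entryE.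
    have /forallP/(_ d)/implyP := anti c; apply.
    by rewrite rc rd cc cd !eqxx.
move=> sY; have cell (c : staircase n) : cell_row c + cell_col c < n by exact: valP c.
apply/andP; split; first apply/and3P; first split; apply/forallP=> c.
- by rewrite -tableau_entryE (sf_gt0 sY).
- apply/forallP=> d; apply/implyP=> /andP[/eqP rcd cdd].
  by rewrite -!tableau_entryE rcd (sf_row sY).
- apply/forallP=> d; apply/implyP=> /andP[/eqP rcd cdd].
  by rewrite -!tableau_entryE rcd (sf_col sY) // -rcd.
- apply/forallP=> d; apply/implyP=> /andP[/eqP rcd /eqP ccd].
  rewrite -!tableau_entryE rcd ccd; apply: (sf_anti sY).
  by rewrite -rcd.
Qed.

Definition cube3 m (i j k : 'I_m) : {ffun 'I_3 -> 'I_m} :=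
  [ffun a : 'I_3 => if val a == 0 then i else if val a == 1 then j else k].

Lemma cube3_in m (t : 'M['I_m.+1]_m) (i j k : 'I_m) :
  (cube3 i j k \in cubes t) = (k < t i j).
Proof. by rewrite inE !ffunE /= !inordK. Qed.

Lemma permute_cube_inj m (s : 'S_3) : injective (@permute_cube m s).
Proof.
move=> c d /ffunP eqcd; apply/ffunP => a.
by have := eqcd ((s^-1)%g a); rewrite !ffunE permKV.
Qed.

Lemma totally_symmetricP m (t : 'M['I_m.+1]_m) :
  reflect (forall (s : 'S_3) c, (permute_cube s c \in cubes t) = (c \in cubes t))
          (totally_symmetric t).
Proof.
apply: (iffP forallP) => [sym s c | sym s].
  by rewrite -{1}(eqP (sym s)) mem_imset //; apply: permute_cube_inj.
rewrite eqEcard card_imset ?leqnn ?andbT; last exact: permute_cube_inj.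
by apply/subsetP=> _ /imsetP[c ct ->]; rewrite sym.
Qed.

(** The transpositions of the first two and of the last two coordinates generate the symmetric
    group. *)
Lemma totally_symmetric_swapP m (t : 'M['I_m.+1]_m) :
  totally_symmetric t <->
  (forall i j k : 'I_m, (k < t i j) = (k < t j i)) /\
  (forall i j k : 'I_m, (k < t i j) = (j < t i k)).
Proof.
have I3 : forall a : 'I_3, [|| a == inord 0, a == inord 1 | a == inord 2].
  by case=> [[|[|[|]]] //] a3; rewrite -!val_eqE /= !inordK.
split=> [/totally_symmetricP sym | [sym swap]].
  split=> i j k; rewrite -!cube3_in.
    rewrite -(sym (tperm (inord 0) (inord 1)) (cube3 i j k)).
    apply: (congr1 (fun c => c \in cubes t)); apply/ffunP => a; rewrite !ffunE.
    by case/or3P: (I3 a) => /eqP->;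
      rewrite ?tpermL ?tpermR ?tpermD -?val_eqE /= ?inordK.
  rewrite -(sym (tperm (inord 1) (inord 2)) (cube3 i j k)).
  apply: (congr1 (fun c => c \in cubes t)); apply/ffunP => a; rewrite !ffunE.
  by case/or3P: (I3 a) => /eqP->;
    rewrite ?tpermL ?tpermR ?tpermD -?val_eqE /= ?inordK.
apply/totally_symmetricP => s c; rewrite !inE !ffunE.
have neq a b : a != b -> s a == s b = false by move/negPf <-; apply/inj_eq/perm_inj.
have n01 : (inord 0 : 'I_3) != inord 1 by rewrite -val_eqE /= !inordK.
have n02 : (inord 0 : 'I_3) != inord 2 by rewrite -val_eqE /= !inordK.
have n12 : (inord 1 : 'I_3) != inord 2 by rewrite -val_eqE /= !inordK.
move: (neq _ _ n01) (neq _ _ n02) (neq _ _ n12).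
(* Of the 27 triples of values of [s], injectivity leaves the six permutations, each a composite of
   the two exchanges. *)
case/or3P: (I3 (s (inord 0))) => /eqP->; case/or3P: (I3 (s (inord 1))) => /eqP->;
  case/or3P: (I3 (s (inord 2))) => /eqP->; rewrite ?eqxx // => _ _ _.
- by rewrite swap sym.
- by rewrite sym swap.
- by rewrite swap sym swap.
Qed.

Lemma tsscpp_funP n (t : 'M['I_(2 * n).+1]_(2 * n)) :
  t \in TSSCPP n <-> tsscpp_fun (2 * n) (entry t).
Proof.
rewrite inE; split.
  case/and3P=> /andP[_ /forallP col] /totally_symmetric_swapP[sym swap] /forallP compl.
  split=> [x y xm ym | x x' y xx' xm ym | x y xm ym | x y z xm ym zm | x y xm ym].
  - by rewrite (entryE _ (Ordinal xm) (Ordinal ym)) -ltnS.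
  - have xm' := leq_ltn_trans xx' xm.
    rewrite (entryE _ (Ordinal xm) (Ordinal ym)) (entryE _ (Ordinal xm') (Ordinal ym)).
    by have /forallP/(_ (Ordinal xm))/forallP/(_ (Ordinal ym))/implyP := col (Ordinal xm'); apply.
  - rewrite (entryE _ (Ordinal xm) (Ordinal ym)) (entryE _ (Ordinal ym) (Ordinal xm)).
    apply: (@eq_from_ltn (2 * n)) => [||z zm]; [by case: (t _ _) | by case: (t _ _) |].
    exact: (sym _ _ (Ordinal zm)).
  - rewrite (entryE _ (Ordinal xm) (Ordinal ym)) (entryE _ (Ordinal xm) (Ordinal zm)).
    exact: (swap _ (Ordinal ym) (Ordinal zm)).
  - rewrite (entryE _ (Ordinal xm) (Ordinal ym)).
    rewrite (entryE _ (rev_ord (Ordinal xm)) (rev_ord (Ordinal ym))).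
    by have /forallP/(_ (Ordinal ym))/eqP := compl (Ordinal xm).
move=> tT; apply/and3P; split.
- apply/andP; split; apply/forallP=> i; apply/forallP=> j; apply/forallP=> k.
    (* Monotonicity along rows is that along columns, transposed. *)
    apply/implyP=> jk; rewrite -!entryE !(tf_sym tT (x := i)) //.
    exact: tf_dec tT _ _ _ _ _ _.
  by apply/implyP=> ij; rewrite -!entryE; apply: tf_dec tT _ _ _ _ _ _.
- apply/totally_symmetric_swapP; split=> i j k; rewrite -!entryE.
    by rewrite (tf_sym tT).
  exact: tf_swap tT _ _ _ _ _ _.
- apply/forallP=> i; apply/forallP=> j; rewrite -!entryE; apply/eqP.
  exact: tf_compl tT _ _ _ _.
Qed.

Lemma eq_tsscpp_fun m T U : tsscpp_fun m T ->
  (forall x y, x < m -> y < m -> U x y = T x y) -> tsscpp_fun m U.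
Proof.
move=> tT UT.
split=> [x y xm ym | x x' y xx' xm ym | x y xm ym | x y z xm ym zm | x y xm ym];
  rewrite !UT ?(leq_ltn_trans xx') //; try lia.
- exact: tf_le tT _ _ _ _.
- exact: tf_dec tT _ _ _ _ _ _.
- exact: tf_sym tT _ _ _ _.
- exact: tf_swap tT _ _ _ _ _ _.
- exact: tf_compl tT _ _ _ _.
Qed.

(** * The bijection between the finite sets *)

(** [inord] does not alter the values when [t] is in [TSSCPP n], since they are then at most [n]. *)
Definition tableau n (t : 'M['I_(2 * n).+1]_(2 * n)) :
    {ffun staircase n -> 'I_n.+1} :=
  [ffun c => inord (tableau_of n (entry t) (cell_row c) (cell_col c))].

Lemma entry_tableau n t a b : t \in TSSCPP n -> a + b < n ->
  tableau_entry (tableau t) a b = tableau_of n (entry t) a b.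
Proof.
move=> /tsscpp_funP/sst_tableau_of sY abn.
have [c [<- <-]] := staircaseP abn.
rewrite tableau_entryE ffunE inordK // ltnS; apply: sf_le sY _ _ _.
exact: valP c.
Qed.

Lemma tableau_SST n t : t \in TSSCPP n -> tableau t \in SST n.
Proof.
move=> tP; apply/sst_funP.
apply: (eq_sst_fun (sst_tableau_of (iffLR (tsscpp_funP t) tP))) => a b.
exact: entry_tableau.
Qed.

Definition partition_of n (y : {ffun staircase n -> 'I_n.+1}) :=
  fill_mx (2 * n) (fill n (corner_of n (tableau_entry y))).

Lemma entry_partition n (y : {ffun staircase n -> 'I_n.+1}) a b :
  a < 2 * n -> b < 2 * n ->
  entry (partition_of y) a b = fill n (corner_of n (tableau_entry y)) a b.
Proof. by move=> am bm; rewrite fill_mxE // => *; apply: fill_le. Qed.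

Lemma partition_TSSCPP n (y : {ffun staircase n -> 'I_n.+1}) :
  y \in SST n -> partition_of y \in TSSCPP n.
Proof.
move=> /sst_funP sY; apply/tsscpp_funP.
exact: eq_tsscpp_fun (tsscpp_fill (corner_corner_of sY)) (@entry_partition n y).
Qed.

Lemma tableauK n t : t \in TSSCPP n -> partition_of (tableau t) = t.
Proof.
move=> tP; have /tsscpp_funP tT := tP; apply/matrixP => i j; apply: val_inj.
rewrite /= -!entryE entry_partition // (tableau_ofK tT) // => a b.
exact: entry_tableau.
Qed.

Lemma partition_ofK n (y : {ffun staircase n -> 'I_n.+1}) :
  y \in SST n -> tableau (partition_of y) = y.
Proof.
move=> yP; have /sst_funP sY := yP; apply/ffunP => c; apply: val_inj.
have abn : cell_row c + cell_col c < n := valP c.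
rewrite /= -!tableau_entryE entry_tableau ?partition_TSSCPP //.
by rewrite -[RHS](corner_ofK sY) // /tableau_of entry_partition //; lia.
Qed.

Theorem theorem3 (n : nat) (hn : 1 <= n) :
  exists f : {t | t \in TSSCPP n} -> {y | y \in SST n}, bijective f.
Proof.
exists (fun t => exist _ (tableau (val t)) (tableau_SST (valP t))).
exists (fun y => exist _ (partition_of (val y)) (partition_TSSCPP (valP y))).
  by move=> [t tP]; apply: val_inj; apply: tableauK.
by move=> [y yP]; apply: val_inj; apply: partition_ofK.
Qed.
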